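(* Let $D>1$ be a squarefree integer, $K=\mathbb{Q}(\sqrt{D})$, and $\mathcal{O}_K=\mathbb{Z}[\delta]$ its ring of integers, where $\delta=-\sqrt{D}$ if $D\not\equiv 1 \pmod 4$ and $\delta=\frac{1-\sqrt{D}}{2}$ if $D\equiv 1\pmod 4$. There can be at most finitely many ideals in $\mathcal{O}_K$, up to similarity of the resulting ideal lattices, whose canonical basis is WR twistable. Moreover, if the canonical basis $a,\ b+g\delta$ of some ideal $I\subseteq\mathcal{O}_K$ is WR twistable, then $$b<\begin{cases} g\sqrt{D} & \text{if } D\not\equiv 1 \pmod 4,\\ \frac{(\sqrt{D}-1)g}{2} & \text{if } D\equiv 1\pmod 4.\end{cases}$$ Finally, the canonical basis of $\mathcal{O}_K$ itself is WR twistable if and only if $K=\mathbb{Q}(\sqrt{5})$.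
   Context: Canonical basis: every nonzero ideal $I\subseteq\mathcal{O}_K$ can be written uniquely as $I=\{ax+(b+g\delta)y: x,y\in\mathbb{Z}\}$ with $a,b,g\in\mathbb{Z}_{\ge 0}$ satisfying $b<a$, $g\mid a$, $g\mid b$, and $ag\mid \mathbb{N}(b+g\delta)$, where $\mathbb{N}$ is the field norm; $a,\ b+g\delta$ is called the canonical basis of $I$. Let $\sigma_1,\sigma_2$ be the two real embeddings ($\sigma_1(x+y\sqrt D)=x+y\sqrt D$, $\sigma_2(x+y\sqrt D)=x-y\sqrt D$) and $\sigma_K=(\sigma_1,\sigma_2):K\to\mathbb{R}^2$. The canonical basis gives the basis matrix $B$ of the lattice $\sigma_K(I)$ with columns $\sigma_K(a)$ and $\sigma_K(b+g\delta)$. For totally positive $\alpha\in K$ (i.e. $\sigma_1(\alpha),\sigma_2(\alpha)>0$) let $A(\alpha)=\mathrm{diag}(\sqrt{\sigma_1(\alpha)},\sqrt{\sigma_2(\alpha)})$. A planar lattice is well-rounded (WR) if it has two linearly independent vectors both of length equal to its minimal nonzero vector length. A basis $v_1,v_2$ of a planar lattice is Minkowski reduced if $\|v_1\|$ is the minimal nonzero length in the lattice and $v_2$ has minimal length among vectors $x$ such that $v_1,x$ is a basis. The canonical basis is called WR twistable if there is a totally positive $\alpha\in K$ such that the columns of $A(\alpha)B$ form a Minkowski reduced basis of the WR lattice $A(\alpha)B\mathbb{Z}^2$. Two lattices are similar if they are related by a dilation composed with an orthogonal transformation. *)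

(* Defs.v *)
From HB Require Import structures.
From mathcomp Require Import all_boot all_order all_algebra all_field.
From mathcomp Require Import boolp classical_sets cardinality reals.

Set Implicit Arguments.
Unset Strict Implicit.
Unset Printing Implicit Defensive.

Import Order.TTheory GRing.Theory Num.Theory.

Local Open Scope classical_set_scope.
Local Open Scope ring_scope.

Definition squarefree (D : nat) : Prop :=
  forall d : nat, (d ^ 2 %| D)%N -> d = 1%N.

(* K = Q(sqrt D), with s in the role of sqrt D.  A number field is a
   splittingFieldType (rather than a mere fieldExtType) over rat so that the
   field norm galNorm is available; this is no restriction on quadratic
   fields, which are all normal. *)
Definition is_Qsqrt (K : splittingFieldType rat) (D : nat) (s : K) : Prop :=
  s ^+ 2 = D%:R /\ <<1; s>>%VS = fullv.

(* The ring of integers: elements that are roots of a monic polynomial over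
   the integers. *)
Definition ring_of_integers (K : splittingFieldType rat) : set K :=
  [set x | integralOver (intr : int -> K) x].
Arguments ring_of_integers : clear implicits.

Definition delta (K : splittingFieldType rat) (D : nat) (s : K) : K :=
  if (D %% 4 == 1)%N then (1 - s) / 2 else - s.

(* MathComp's own ideals are proper; here O_K itself must be an ideal. *)
Definition is_ideal (K : splittingFieldType rat) (I : set K) : Prop :=
  [/\ I `<=` ring_of_integers K,
      I 0,
      forall x y, I x -> I y -> I (x + y)
    & forall c x, ring_of_integers K c -> I x -> I (c * x)].

Definition is_nonzero_ideal (K : splittingFieldType rat) (I : set K) : Prop :=
  is_ideal I /\ exists2 x, I x & x != 0.

Definition second_basis_elt (K : splittingFieldType rat) (D : nat) (s : K)
    (b g : nat) : K := b%:R + g%:R * delta D s.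

Definition is_canonical_basis (K : splittingFieldType rat) (D : nat) (s : K)
    (I : set K) (a b g : nat) : Prop :=
  let beta := second_basis_elt D s b g in
  [/\ I = [set z | exists x y : int, z = a%:R * x%:~R + beta * y%:~R],
      (b < a)%N,
      (g %| a)%N,
      (g %| b)%N
    & exists2 n : int, galNorm 1 {:K} beta = n%:~R & ((a * g)%:Z %| n)%Z].

Section Plane.
Context {R : realType}.

(* The Euclidean length (the library norm on matrices is the sup norm). *)
Definition enorm (v : 'cV[R]_2) : R := Num.sqrt (\sum_(i < 2) v i 0 ^+ 2).

Definition lattice_of (B : 'M[R]_2) : set 'cV[R]_2 :=
  [set v | exists z : 'cV[int]_2, v = B *m map_mx intr z].

Definition is_minimal_vector (L : set 'cV[R]_2) (v : 'cV[R]_2) : Prop :=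
  [/\ L v, v != 0 & forall w, L w -> w != 0 -> enorm v <= enorm w].

Definition well_rounded (L : set 'cV[R]_2) : Prop :=
  exists u v : 'cV[R]_2,
    [/\ is_minimal_vector L u, is_minimal_vector L v & free [:: u; v]].

Definition is_lattice_basis (L : set 'cV[R]_2) (v1 v2 : 'cV[R]_2) : Prop :=
  free [:: v1; v2] /\ L = lattice_of (row_mx v1 v2).

Definition Minkowski_reduced (L : set 'cV[R]_2) (v1 v2 : 'cV[R]_2) : Prop :=
  [/\ is_lattice_basis L v1 v2,
      is_minimal_vector L v1
    & forall x, is_lattice_basis L v1 x -> enorm v2 <= enorm x].

Definition similar_lattices (L1 L2 : set 'cV[R]_2) : Prop :=
  exists (c : R) (U : 'M[R]_2),
    [/\ 0 < c, U^T *m U = 1%:M & L2 = [set c *: (U *m v) | v in L1]].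

End Plane.

Section Embeddings.
Context {K : splittingFieldType rat} {R : realType}.

Definition sigmaK (sigma1 sigma2 : {rmorphism K -> R}) (x : K) : 'cV[R]_2 :=
  \col_(i < 2) (if i == 0 then sigma1 x else sigma2 x).

Definition basis_matrix (sigma1 sigma2 : {rmorphism K -> R}) (x y : K)
    : 'M[R]_2 :=
  row_mx (sigmaK sigma1 sigma2 x) (sigmaK sigma1 sigma2 y).

Definition twist_matrix (sigma1 sigma2 : {rmorphism K -> R}) (alpha : K)
    : 'M[R]_2 :=
  diag_mx (map_mx Num.sqrt (sigmaK sigma1 sigma2 alpha)^T).

Definition totally_positive (sigma1 sigma2 : {rmorphism K -> R}) (alpha : K)
    : Prop :=
  0 < sigma1 alpha /\ 0 < sigma2 alpha.

Definition WR_twistable (sigma1 sigma2 : {rmorphism K -> R}) (x y : K)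
    : Prop :=
  exists alpha : K,
    let AB := twist_matrix sigma1 sigma2 alpha
              *m basis_matrix sigma1 sigma2 x y in
    [/\ totally_positive sigma1 sigma2 alpha,
        Minkowski_reduced (lattice_of AB) (col 0 AB) (col 1 AB)
      & well_rounded (lattice_of AB)].

Definition canonical_basis_WR_twistable (D : nat) (s : K)
    (sigma1 sigma2 : {rmorphism K -> R}) (I : set K) : Prop :=
  exists a b g : nat,
    is_canonical_basis D s I a b g /\
    WR_twistable sigma1 sigma2 a%:R (second_basis_elt D s b g).

End Embeddings.

(* Main.v *)
(* A Minkowski reduced basis u, v spans a well-rounded lattice iff |u| = |v| and
   2|<u, v>| <= |u|^2. For the twisted canonical basis, with x1 < x2 the
   conjugates of b + g delta and p, q > 0 those of alpha, the first condition is
   p (a^2 - x1^2) = q (x2^2 - a^2); it forces x1^2 < a^2 < x2^2 and determines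
   the ratio p / q, and the second condition becomes
   2 |a^2 + x1 x2| <= a (x1 + x2), in which alpha no longer occurs.
   If x1 >= 0 this gives 2 a <= x1 + x2 <= 2 b + g, against b + g <= a; so x1 < 0,
   which is the bound on b. Together with a < x2 it bounds a / g and b / g in
   terms of D, and these two integers determine the lattice up to dilation.
   For O_K one has (a, b, g) = (1, 0, 1), and the inequality leaves only D = 5,
   where alpha = (5 + sqrt 5) / 2 works. *)
Require Import Defs.
From HB Require Import structures.
From mathcomp Require Import all_boot all_order all_algebra all_field.
From mathcomp Require Import boolp classical_sets cardinality reals.
From mathcomp Require Import ring lra zify.

Set Implicit Arguments.
Unset Strict Implicit.
Unset Printing Implicit Defensive.

Import Order.TTheory GRing.Theory Num.Theory.

Local Open Scope classical_set_scope.
Local Open Scope ring_scope.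

(** * Planar lattices: reduced bases and well-roundedness *)

Section PlaneLattice.
Context {R : realType}.
Implicit Types u v w : 'cV[R]_2.

(** Lengths are compared through their squares, which keeps square roots out of the algebra. *)
Definition dot2 u v : R := u 0 0 * v 0 0 + u 1 0 * v 1 0.

Definition det2 u v : R := u 0 0 * v 1 0 - u 1 0 * v 0 0.

Lemma cV2P u v : u 0 0 = v 0 0 -> u 1 0 = v 1 0 -> u = v.
Proof.
move=> h0 h1; apply/matrixP => i j; rewrite (ord1 j).
have [->|->] // : i = 0 \/ i = 1.
by case: i => [[|[|//]] hi]; [left|right]; apply: val_inj.
Qed.

Lemma cV2_eq0 u : (u == 0) = (u 0 0 == 0) && (u 1 0 == 0).
Proof.
apply/eqP/andP => [->|[/eqP h0 /eqP h1]]; first by rewrite !mxE.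
by apply: cV2P; rewrite mxE.
Qed.

Lemma dot2_ge0 u : 0 <= dot2 u u.
Proof. by rewrite addr_ge0 // -expr2 sqr_ge0. Qed.

Lemma dot2_gt0 u : u != 0 -> 0 < dot2 u u.
Proof.
move=> u0; rewrite lt_def dot2_ge0 andbT; apply: contra u0 => /eqP h.
rewrite /dot2 in h.
by rewrite cV2_eq0; apply/andP; split; apply/eqP; nra.
Qed.

Lemma enormE u : enorm u = Num.sqrt (dot2 u u).
Proof.
by rewrite /enorm /dot2 big_ord_recl big_ord1 !expr2 (_ : lift ord0 ord0 = 1) //;
  apply: val_inj.
Qed.

Lemma ler_enorm u v : (enorm u <= enorm v) = (dot2 u u <= dot2 v v).
Proof. by rewrite !enormE ler_sqrt // dot2_ge0. Qed.

Lemma free2E u v : free [:: u; v] = (det2 u v != 0).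
Proof.
rewrite free_cons span_seq1 seq1_free.
apply/andP/idP => [[huv v0]|huv].
  apply: contra huv => /eqP; rewrite /det2 => h.
  have h2 := lt0r_neq0 (dot2_gt0 v0).
  (* With vanishing determinant, [u] equals its orthogonal projection onto [v]. *)
  apply/vlineP; exists (dot2 u v / dot2 v v).
  apply: cV2P; rewrite !mxE mulrAC; apply: (mulIf h2); rewrite mulfVK //.
    rewrite -[RHS](addr0 _) -(mul0r (v 1 0)) -h /dot2; ring.
  rewrite -[RHS](subr0 _) -(mul0r (v 0 0)) -h /dot2; ring.
split; apply: contra huv; last by move=> /eqP ->; rewrite /det2 !mxE !mulr0 subrr.
by move=> /vlineP[k ->]; rewrite /det2 !mxE; apply/eqP; ring.
Qed.

Lemma row_mx2_0 u v i : row_mx u v i 0 = u i 0.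
Proof. by rewrite -(row_mxEl u v i 0); congr (row_mx u v i _); apply: val_inj. Qed.

Lemma row_mx2_1 u v i : row_mx u v i 1 = v i 0.
Proof. by rewrite -(row_mxEr u v i 0); congr (row_mx u v i _); apply: val_inj. Qed.

Lemma row_mx_mul2 u v (z : 'cV[R]_2) : row_mx u v *m z = z 0 0 *: u + z 1 0 *: v.
Proof.
have -> : row_mx u v *m z = \col_i (z 0 0 * u i 0 + z 1 0 * v i 0).
  apply/matrixP => i j; rewrite (ord1 j) !mxE big_ord_recl big_ord1.
  rewrite (_ : lift ord0 ord0 = 1) ?row_mx2_0 ?row_mx2_1; last exact: val_inj.
  by rewrite mulrC [v i 0 * _]mulrC.
by apply: cV2P; rewrite !mxE.
Qed.

Lemma lattice_of_row u v :
  lattice_of (row_mx u v) =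
  [set w | exists m n : int, w = m%:~R *: u + n%:~R *: v].
Proof.
apply/seteqP; split => w /=.
  by move=> [z ->]; exists (z 0 0), (z 1 0); rewrite row_mx_mul2 !mxE.
move=> [m [n ->]]; exists (\col_i if i == 0 then m else n).
by rewrite row_mx_mul2 !mxE.
Qed.

Lemma lattice_of_row_addl u v (e : int) :
  lattice_of (row_mx u (v + e%:~R *: u)) = lattice_of (row_mx u v).
Proof.
rewrite !lattice_of_row; apply/seteqP; split => w /= [m [n ->]].
  by exists (m + e * n), n; apply: cV2P; rewrite !mxE rmorphD rmorphM /=; ring.
by exists (m - e * n), n; apply: cV2P; rewrite !mxE rmorphB rmorphM /=; ring.
Qed.

Lemma det2_addl u v (e : R) : det2 u (v + e *: u) = det2 u v.
Proof. rewrite /det2 !mxE; ring. Qed.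

Lemma dot2_comb u v (a b : R) :
  dot2 (a *: u + b *: v) (a *: u + b *: v) =
  a ^+ 2 * dot2 u u + a * b * (2 * dot2 u v) + b ^+ 2 * dot2 v v.
Proof. rewrite /dot2 !mxE; ring. Qed.

(** From (m - n)^2 >= 0 and (m + n)^2 >= 0 the form is at least (m^2 + n^2) / 2, hence positive;
    being integral, it is then at least 1. *)
Lemma hex_form_ge1 (m n : int) : (m, n) != (0, 0) ->
  1 <= (m ^+ 2 + n ^+ 2)%:~R - `|m%:~R * n%:~R| :> R.
Proof.
move=> mn0; rewrite -intrM -intr_norm -intrB ler1z.
have : 0 < m ^+ 2 + n ^+ 2 - `|m * n|; last by lia.
move: mn0; rewrite xpair_eqE negb_and -(sqrf_eq0 m) -(sqrf_eq0 n) => mn0.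
have := sqr_ge0 m; have := sqr_ge0 n; have := sqr_ge0 (m + n); have := sqr_ge0 (m - n).
rewrite sqrrB sqrrD.
move: mn0; set x := m ^+ 2; set y := n ^+ 2; set z := m * n; lia.
Qed.

(** The cross term is at least -|mn| [dot2 u u]. The excess of [dot2 v v] over [dot2 u u] is kept
    apart, so that the bound serves both when the lengths agree and when [v] is strictly longer. *)
Lemma dot2_comb_ge u v (m n : int) :
  `|2 * dot2 u v| <= dot2 u u ->
  dot2 u u * ((m ^+ 2 + n ^+ 2)%:~R - `|m%:~R * n%:~R|)
    + n%:~R ^+ 2 * (dot2 v v - dot2 u u) <=
  dot2 (m%:~R *: u + n%:~R *: v) (m%:~R *: u + n%:~R *: v).
Proof.
move=> huv; rewrite dot2_comb intrD !rmorphXn /=.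
have : `|m%:~R * n%:~R * (2 * dot2 u v)| <= `|m%:~R * n%:~R| * dot2 u u :> R.
  by rewrite normrM ler_wpM2l.
rewrite ler_norml => /andP[h _]; move: h.
set x := `|_ * _|; set y := _ * _ * (2 * _).
set a := m%:~R; set b := n%:~R; set U := dot2 u u; set V := dot2 v v.
rewrite -subr_ge0 => h; rewrite -subr_ge0.
by rewrite (_ : _ - _ = y - - (x * U)) //; ring.
Qed.

(** The angle condition comes from comparing [v] with [v + u] and [v - u], which also complete [u]
    to a basis. If [v] were strictly longer than [u], all minimal vectors would be multiples of [u],
    and no two of them would be independent. *)
Lemma reduced_WR_eq u v (L := lattice_of (row_mx u v)) :
  Minkowski_reduced L u v -> well_rounded L ->
  dot2 v v = dot2 u u /\ `|2 * dot2 u v| <= dot2 u u.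
Proof.
move=> [[+ _] [uL u0 umin] vmin] [w1 [w2 []]].
rewrite free2E => fuv [w1L w10 w1min] [w2L w20 w2min] fw.
have huv : `|2 * dot2 u v| <= dot2 u u.
  have h (e : int) : dot2 v v <= dot2 (v + e%:~R *: u) (v + e%:~R *: u).
    rewrite -ler_enorm; apply: vmin; split; last by rewrite lattice_of_row_addl.
    by rewrite free2E det2_addl.
  have := h 1; have := h (-1).
  by rewrite rmorphN !rmorph1 /dot2 !mxE ler_norml => h1 h2; apply/andP; split; nra.
split => //; apply/eqP; rewrite eq_le; apply/andP; split; last first.
  rewrite -ler_enorm; apply: umin.
    rewrite /L lattice_of_row; exists 0, 1.
    by rewrite rmorph0 rmorph1 scale0r scale1r add0r.
  by apply: contra fuv => /eqP ->; rewrite /det2 !mxE !mulr0 subrr.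
rewrite leNgt; apply/negP => uv_lt.
(* A coefficient n <> 0 on [v] makes the squared length at least |u|^2 + n^2 (|v|^2 - |u|^2), which
   exceeds |u|^2. *)
have minu w : L w -> w != 0 -> (forall w', L w' -> w' != 0 -> enorm w <= enorm w') ->
    exists m : int, w = m%:~R *: u.
  rewrite {1}/L lattice_of_row => -[m [n ->]] w0 /(_ u uL u0).
  rewrite ler_enorm => /(le_trans (dot2_comb_ge m n huv)) h.
  have [n0|n0] := eqVneq n 0; first by exists m; rewrite n0 scale0r addr0.
  have hex : 1 <= (m ^+ 2 + n ^+ 2)%:~R - `|m%:~R * n%:~R| :> R.
    by apply: hex_form_ge1; rewrite xpair_eqE negb_and n0 orbT.
  have n2 : 0 < n%:~R ^+ 2 :> R by rewrite exprn_even_gt0 //= intr_eq0.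
  have u2 := dot2_gt0 u0.
  have hu : 0 < n%:~R ^+ 2 * (dot2 v v - dot2 u u) by rewrite mulr_gt0 ?subr_gt0.
  nra.
have [m1 w1E] := minu w1 w1L w10 w1min.
have [m2 w2E] := minu w2 w2L w20 w2min.
by move: fw; rewrite w1E w2E free2E /det2 !mxE => /negP[]; apply/eqP; ring.
Qed.

(** For equal lengths the lower bound is |u|^2 times the form of [hex_form_ge1], so [u] and [v] are
    both minimal. Any other completion of [u] to a basis is a nonzero lattice vector and cannot be
    shorter. *)
Lemma eq_norms_reduced_WR u v (L := lattice_of (row_mx u v)) :
  det2 u v != 0 -> dot2 v v = dot2 u u -> `|2 * dot2 u v| <= dot2 u u ->
  Minkowski_reduced L u v /\ well_rounded L.
Proof.
move=> fuv uv_eq huv.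
have u0 : u != 0.
  by apply: contra fuv => /eqP ->; rewrite /det2 !mxE !mul0r subrr.
have v0 : v != 0.
  by apply: contra fuv => /eqP ->; rewrite /det2 !mxE !mulr0 subrr.
have uL : L u.
  by rewrite /L lattice_of_row; exists 1, 0; rewrite rmorph0 rmorph1 scale0r scale1r addr0.
have vL : L v.
  by rewrite /L lattice_of_row; exists 0, 1; rewrite rmorph0 rmorph1 scale0r scale1r add0r.
have umin w : L w -> w != 0 -> enorm u <= enorm w.
  rewrite {1}/L lattice_of_row => -[m [n ->]] w0; rewrite ler_enorm.
  apply: le_trans (dot2_comb_ge m n huv); rewrite uv_eq subrr mulr0 addr0.
  rewrite ler_peMr ?dot2_ge0 //; apply: hex_form_ge1.
  apply: contra w0 => /eqP[-> ->].
  by rewrite rmorph0 !scale0r addr0.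
have vu : enorm v = enorm u by rewrite !enormE uv_eq.
split; last first.
  exists u, v; split; last by rewrite free2E.
    by split.
  by split => //; rewrite vu.
split; [by split; rewrite ?free2E | by split | move=> x [fx Lx]].
rewrite vu; apply: umin; last first.
  by move: fx; rewrite free2E; apply: contra => /eqP ->; rewrite /det2 !mxE !mulr0 subrr.
by rewrite Lx lattice_of_row; exists 0, 1; rewrite rmorph0 rmorph1 scale0r scale1r add0r.
Qed.

End PlaneLattice.

(** * The twisting condition in terms of conjugates *)

Lemma col_twist_basisE (R : realType) (K : splittingFieldType rat)
    (sigma1 sigma2 : {rmorphism K -> R}) (alpha x y : K) (i j : 'I_2) :
  (twist_matrix sigma1 sigma2 alpha *m basis_matrix sigma1 sigma2 x y) i j =
  Num.sqrt (if i == 0 then sigma1 alpha else sigma2 alpha)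
    * (if i == 0 then sigma1 (if j == 0 then x else y)
       else sigma2 (if j == 0 then x else y)).
Proof.
rewrite /twist_matrix mul_diag_mx mxE; congr (_ * _); first by rewrite !mxE.
have [->|->] : j = 0 \/ j = 1.
  by case: j => [[|[|//]] hj]; [left|right]; apply: val_inj.
  by rewrite /basis_matrix row_mx2_0 mxE.
by rewrite /basis_matrix row_mx2_1 mxE.
Qed.

(** Twisting weights the two coordinates of a dot product by the conjugates p and q of alpha, so the
    square roots cancel. The determinant only gains the nonzero factor sqrt (p q). *)
Lemma WR_twistableP (R : realType) (K : splittingFieldType rat)
    (sigma1 sigma2 : {rmorphism K -> R}) (x y : K) :
  WR_twistable sigma1 sigma2 x y <->
  exists alpha : K,
    let p := sigma1 alpha in let q := sigma2 alpha in
    [/\ 0 < p, 0 < q, sigma1 x * sigma2 y - sigma2 x * sigma1 y != 0,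
        p * sigma1 y ^+ 2 + q * sigma2 y ^+ 2
          = p * sigma1 x ^+ 2 + q * sigma2 x ^+ 2
      & `|2 * (p * sigma1 x * sigma1 y + q * sigma2 x * sigma2 y)|
          <= p * sigma1 x ^+ 2 + q * sigma2 x ^+ 2].
Proof.
have E alpha (p := sigma1 alpha) (q := sigma2 alpha) : 0 < p -> 0 < q ->
    let M := twist_matrix sigma1 sigma2 alpha *m basis_matrix sigma1 sigma2 x y in
    let u := col 0 M in let v := col 1 M in
    [/\ M = row_mx u v,
        det2 u v = Num.sqrt (p * q) * (sigma1 x * sigma2 y - sigma2 x * sigma1 y),
        dot2 u u = p * sigma1 x ^+ 2 + q * sigma2 x ^+ 2,
        dot2 v v = p * sigma1 y ^+ 2 + q * sigma2 y ^+ 2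
      & dot2 u v = p * sigma1 x * sigma1 y + q * sigma2 x * sigma2 y].
  move=> p0 q0 M u v.
  have Sq (r t z : R) : 0 < r -> Num.sqrt r * t * (Num.sqrt r * z) = r * t * z.
    by move=> r0; rewrite mulrACA -expr2 sqr_sqrtr ?ltW // mulrA.
  have u0 : u 0 0 = Num.sqrt p * sigma1 x by rewrite mxE col_twist_basisE.
  have u1 : u 1 0 = Num.sqrt q * sigma2 x by rewrite mxE col_twist_basisE.
  have v0 : v 0 0 = Num.sqrt p * sigma1 y by rewrite mxE col_twist_basisE.
  have v1 : v 1 0 = Num.sqrt q * sigma2 y by rewrite mxE col_twist_basisE.
  rewrite /det2 /dot2 u0 u1 v0 v1 !Sq //; split; rewrite -?mulrA -?expr2 //.
    apply/matrixP => i j; have [->|->] : j = 0 \/ j = 1.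
    - by case: j => [[|[|//]] hj]; [left|right]; apply: val_inj.
    - by rewrite row_mx2_0 [RHS]mxE.
    - by rewrite row_mx2_1 [RHS]mxE.
  rewrite sqrtrM ?ltW //; move: (Num.sqrt p) (Num.sqrt q) => P Q; ring.
split=> -[alpha].
  move=> /= [[p0 q0] red wr]; exists alpha => /=.
  have [ME dE uuE vvE uvE] := E alpha p0 q0.
  have [[+ _] _ _] := red; rewrite free2E => fuv.
  rewrite [in X in lattice_of X]ME in red; rewrite [in X in lattice_of X]ME in wr.
  have [h1 h2] := reduced_WR_eq red wr.
  split => //.
  - by apply: contra fuv => /eqP h; rewrite dE h mulr0.
  - by rewrite -vvE -uuE.
  - by rewrite -uvE -uuE.
move=> /= [p0 q0 d0 h1 h2]; exists alpha => /=.
have [ME dE uuE vvE uvE] := E alpha p0 q0.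
rewrite [in X in lattice_of X]ME.
set M := _ *m _ in ME dE uuE vvE uvE *.
have [|||red wr] := @eq_norms_reduced_WR R (col 0 M) (col 1 M); last by split.
- by rewrite dE mulf_neq0 // sqrtr_eq0 -ltNge mulr_gt0.
- by rewrite vvE uuE.
- by rewrite uvE uuE.
Qed.

(** The equation reads p (a^2 - x1^2) = q (x2^2 - a^2). If x2 <= a, both sides vanish and x2 = a, x1
    = -a, the case excluded by the last hypothesis on x1 + x2. Otherwise alpha can be eliminated
    from the angle condition. *)
Lemma twist_bounds (F : realFieldType) (p q a x1 x2 : F) :
  0 < p -> 0 < q -> 0 < a -> x1 < x2 -> 0 <= x1 + x2 ->
  (x1 + x2 = 0 -> x2 != a) ->
  p * x1 ^+ 2 + q * x2 ^+ 2 = p * a ^+ 2 + q * a ^+ 2 ->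
  `|2 * (p * a * x1 + q * a * x2)| <= p * a ^+ 2 + q * a ^+ 2 ->
  a < x2 /\ `|2 * (a ^+ 2 + x1 * x2)| <= a * (x1 + x2).
Proof.
move=> p0 q0 a0 x12 x12p nz eq ang.
have x20 : 0 < x2 by lra.
have x12sq : x1 ^+ 2 <= x2 ^+ 2 by rewrite -subr_ge0 subr_sqr; nra.
have ax2 : a < x2.
  rewrite ltNge; apply/negP => x2a.
  have x2asq : x2 ^+ 2 <= a ^+ 2 by rewrite -subr_ge0 subr_sqr; nra.
  have pe : p * (a ^+ 2 - x1 ^+ 2) = 0.
    have h1 : 0 <= p * (a ^+ 2 - x1 ^+ 2) by apply: mulr_ge0; lra.
    have h2 : 0 <= q * (a ^+ 2 - x2 ^+ 2) by apply: mulr_ge0; lra.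
    lra.
  have qe : q * (a ^+ 2 - x2 ^+ 2) = 0 by lra.
  move/eqP: pe; rewrite mulf_eq0 (gt_eqF p0) /= subr_eq0 => /eqP pe.
  move/eqP: qe; rewrite mulf_eq0 (gt_eqF q0) /= subr_eq0 eqf_sqr.
  move=> /orP[/eqP ax|/eqP ax]; last by lra.
  have x10 : x1 + x2 = 0.
    move/eqP: pe; rewrite ax eqf_sqr => /orP[] /eqP; lra.
  by have := nz x10; rewrite ax eqxx.
split => //.
have w0 : 0 < x2 ^+ 2 - a ^+ 2 by rewrite subr_sqr; nra.
have pu : p * (a ^+ 2 - x1 ^+ 2) = q * (x2 ^+ 2 - a ^+ 2) by lra.
set u := a ^+ 2 - x1 ^+ 2 in pu; set w := x2 ^+ 2 - a ^+ 2 in w0 pu.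
(* Multiplying the angle condition by [w] and replacing q w by p u leaves the common positive factor
   p a (x2 - x1) on both sides, which cancels. *)
have k0 : 0 < p * a * (x2 - x1) by rewrite !mulr_gt0 ?subr_gt0.
have E1 : 2 * (p * a * x1 + q * a * x2) * w =
    p * a * (x2 - x1) * (2 * (a ^+ 2 + x1 * x2)).
  transitivity (2 * p * a * x1 * w + 2 * a * x2 * (q * w)); first by ring.
  rewrite -pu /u /w; ring.
have E2 : (p * a ^+ 2 + q * a ^+ 2) * w = p * a * (x2 - x1) * (a * (x1 + x2)).
  transitivity (p * a ^+ 2 * w + a ^+ 2 * (q * w)); first by ring.
  rewrite -pu /u /w; ring.
rewrite -(ler_pM2l k0) -{1}(gtr0_norm k0) -normrM -E1 -E2.
by rewrite normrM (gtr0_norm w0) ler_pM2r.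
Qed.

(** This is the irrationality of sqrt D: equality would give g | a, and the square of the quotient
    would be D. *)
Lemma squarefree_sqr_neq (D a g : nat) : (1 < D)%N -> squarefree D ->
  (0 < a)%N -> (a ^ 2 != g ^ 2 * D)%N.
Proof.
move=> D1 Dsf a0; apply/eqP => aE.
have g0 : (0 < g)%N by case: g aE => // /eqP; rewrite mul0n expn_eq0 /=; lia.
have /dvdnP[c cE] : (g %| a)%N by rewrite -(@dvdn_pexp2r _ _ 2) // aE dvdn_mulr.
move: aE; rewrite cE expnMn mulnC => /eqP.
rewrite eqn_pmul2l ?expn_gt0 ?g0 // => /eqP cD.
by have := Dsf c; rewrite -cD dvdnn => /(_ isT) c1; move: D1; rewrite -cD c1.
Qed.

Lemma splitting_rat_natr_eq0 (K : splittingFieldType rat) (n : nat) :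
  (n%:R == 0 :> K) = (n == 0%N).
Proof. by rewrite -(rmorph_nat (GRing.in_alg K)) fmorph_eq0 pnatr_eq0. Qed.

(** * Twistable canonical bases in a real quadratic field *)

Section QuadraticField.
Context (R : realType) (D : nat) (hD1 : (1 < D)%N) (hDsf : squarefree D).
Context (K : splittingFieldType rat) (s : K).
Context (sigma1 sigma2 : {rmorphism K -> R}).
Context (hsigma1 : sigma1 s = Num.sqrt D%:R).
Context (hsigma2 : sigma2 s = - Num.sqrt D%:R).

(* delta has conjugates (tau - omega) / 2 and (tau + omega) / 2. *)
Definition tau : nat := (D %% 4 == 1)%N.
Definition omega : R :=
  if (D %% 4 == 1)%N then Num.sqrt D%:R else 2 * Num.sqrt D%:R.

Lemma sqrtD_gt1 : 1 < Num.sqrt D%:R :> R.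
Proof. by rewrite -[X in X < _]sqrtr1 ltr_sqrt ?ltr1n // ltr0n; lia. Qed.

Lemma omega_gt0 : 0 < omega.
Proof. have := sqrtD_gt1; rewrite /omega; case: ifP => _; lra. Qed.

Lemma sigma1_beta b g :
  sigma1 (second_basis_elt D s b g) = b%:R + g%:R * ((tau%:R - omega) / 2).
Proof.
rewrite /second_basis_elt /delta /tau /omega rmorphD rmorphM !rmorph_nat.
case: ifP => _ /=.
  by rewrite fmorph_div rmorphB rmorph1 hsigma1 rmorph_nat.
by rewrite rmorphN hsigma1; congr (_ + _ * _); field.
Qed.

Lemma sigma2_beta b g :
  sigma2 (second_basis_elt D s b g) = b%:R + g%:R * ((tau%:R + omega) / 2).
Proof.
rewrite /second_basis_elt /delta /tau /omega rmorphD rmorphM !rmorph_nat.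
case: ifP => _ /=.
  by rewrite fmorph_div rmorphB rmorph1 hsigma2 rmorph_nat opprK.
by rewrite rmorphN hsigma2; congr (_ + _ * _); field.
Qed.

(** Two distinct multiples of g differ by at least g, and g = 0 would force a = 0. *)
Lemma canonical_lt (a b g : nat) : (b < a)%N -> (g %| a)%N -> (g %| b)%N ->
  (0 < g)%N /\ (b + g <= a)%N.
Proof.
move=> ba /dvdnP[k aE] /dvdnP[l bE]; subst a b.
have g0 : (0 < g)%N by case: g ba => //; rewrite !muln0.
by move: ba; rewrite ltn_pmul2r // => lk; rewrite g0 -mulSnr leq_pmul2r.
Qed.

Lemma WR_twistable_bounds (a b g : nat) (beta := second_basis_elt D s b g) :
  (b < a)%N -> (g %| a)%N -> (g %| b)%N ->
  WR_twistable sigma1 sigma2 a%:R beta ->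
  [/\ sigma1 beta < 0, a%:R < sigma2 beta
    & `|2 * (a%:R ^+ 2 + sigma1 beta * sigma2 beta)|
        <= a%:R * (sigma1 beta + sigma2 beta)].
Proof.
move=> ba ga gb /WR_twistableP[alpha /= [p0 q0 _ eq ang]].
have [g0 bga] := canonical_lt ba ga gb.
rewrite !rmorph_nat in eq ang.
have om0 := omega_gt0.
have gR : 0 < g%:R :> R by rewrite ltr0n.
have aR : 0 < a%:R :> R by rewrite ltr0n; lia.
have b0 : 0 <= b%:R :> R by [].
have t0 : 0 <= tau%:R :> R by [].
have t1 : tau%:R <= 1 :> R by rewrite /tau lern1 leq_b1.
have baR : b%:R + g%:R <= a%:R :> R by rewrite -natrD ler_nat.
have x12 : sigma1 beta < sigma2 beta.
  by rewrite sigma1_beta sigma2_beta ltrD2l ltr_pM2l //; lra.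
have x1x2 : sigma1 beta + sigma2 beta = 2 * b%:R + g%:R * tau%:R.
  by rewrite sigma1_beta sigma2_beta; field.
have gt : 0 <= g%:R * tau%:R :> R by rewrite mulr_ge0 // ltW.
have gt1 : g%:R * tau%:R <= g%:R :> R by rewrite ler_piMr // ltW.
have [||ax2 bnd] := twist_bounds p0 q0 aR x12 _ _ eq ang.
- by rewrite x1x2 addr_ge0 // mulr_ge0.
(* Trace zero means b = 0 and [tau] = 0, so x2 = a would read a = g sqrt D, contradicting
   irrationality. *)
- rewrite x1x2 => /eqP; rewrite paddr_eq0 ?mulr_ge0 // !mulf_eq0 !pnatr_eq0 /=.
  rewrite (gtn_eqF g0) /= => /andP[/eqP bE /eqP tE].
  apply/eqP; rewrite sigma2_beta /omega; move: tE; rewrite /tau.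
  case: ifP => // _ _; rewrite bE /= !add0r => aE.
  have := squarefree_sqr_neq g hD1 hDsf (leq_ltn_trans (leq0n b) ba).
  rewrite -(eqr_nat R) natrM !natrX -aE => /eqP[].
  by rewrite [2 * _]mulrC mulfK ?pnatr_eq0 // exprMn sqr_sqrtr.
split => //; rewrite ltNge; apply/negP => x10.
move: bnd; rewrite ger0_norm; last first.
  by rewrite mulr_ge0 // addr_ge0 ?sqr_ge0 // mulr_ge0 //; lra.
have : 0 <= sigma1 beta * sigma2 beta by rewrite mulr_ge0 //; lra.
rewrite x1x2; nra.
Qed.

Lemma omega_lt : omega <= (2 * D)%:R.
Proof.
have sD := sqrtD_gt1; have : Num.sqrt D%:R ^+ 2 = D%:R :> R by rewrite sqr_sqrtr.
rewrite /omega natrM; case: ifP => _; nra.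
Qed.

(** As x1 < 0 and a < x2, a is less than x2 - x1 = g [omega], which is at most 2 g D. *)
Lemma WR_twistable_small (a b g : nat) :
  (b < a)%N -> (g %| a)%N -> (g %| b)%N ->
  WR_twistable sigma1 sigma2 a%:R (second_basis_elt D s b g) ->
  (a %/ g < 2 * D)%N /\ (b %/ g < 2 * D)%N.
Proof.
move=> ba ga gb /(WR_twistable_bounds ba ga gb)[].
rewrite sigma1_beta sigma2_beta => b1 a1 _.
have [g0 _] := canonical_lt ba ga gb.
have ag : (a %/ g < 2 * D)%N.
  rewrite ltn_divLR // -(ltr_nat R) natrM mulrC.
  apply: lt_le_trans (_ : g%:R * omega <= _); first by lra.
  by rewrite ler_pM2l ?ltr0n // omega_lt.
by split => //; apply: leq_ltn_trans ag; apply: leq_div2r; apply: ltnW.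
Qed.

(** The elements a / g and b / g + delta are the same for both ideals, so the two bases differ by
    the rational factor g' / g. *)
Lemma canonical_basis_dilation (I J : set K) (a b g a' b' g' : nat) :
  (0 < g)%N -> (0 < g')%N -> (g %| a)%N -> (g %| b)%N -> (g' %| a')%N ->
  (g' %| b')%N -> (a %/ g = a' %/ g')%N -> (b %/ g = b' %/ g')%N ->
  is_canonical_basis D s I a b g -> is_canonical_basis D s J a' b' g' ->
  J = [set (g'%:R / g%:R) * z | z in I].
Proof.
move=> g0 g'0 /divnK {2}<- /divnK {2}<- /divnK {2}<- /divnK {2}<- -> ->.
case=> -> _ _ _ _ [-> _ _ _ _].
set m := (a' %/ g')%N; set n := (b' %/ g')%N.
have gK : g%:R != 0 :> K by rewrite splitting_rat_natr_eq0 -lt0n.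
have E (x y : int) : (m * g')%:R * x%:~R + second_basis_elt D s (n * g') g' * y%:~R =
   (g'%:R / g%:R) * ((m * g)%:R * x%:~R + second_basis_elt D s (n * g) g * y%:~R).
  by rewrite /second_basis_elt !natrM; field.
apply/seteqP; split => z /=.
  move=> [x [y ->]]; rewrite E.
  by exists ((m * g)%:R * x%:~R + second_basis_elt D s (n * g) g * y%:~R);
    [exists x, y |].
by move=> [_ [x [y ->]] <-]; exists x, y; rewrite E.
Qed.

(** Both embeddings fix rational numbers, so a rational factor acts on the plane as a homothety. *)
Lemma similar_dilation (I : set K) (n m : nat) : (0 < n)%N -> (0 < m)%N ->
  similar_lattices (sigmaK sigma1 sigma2 @` I)
    (sigmaK sigma1 sigma2 @` [set (n%:R / m%:R) * z | z in I]).
Proof.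
move=> n0 m0; exists (n%:R / m%:R), 1%:M.
have E z : sigmaK sigma1 sigma2 (n%:R / m%:R * z) =
    (n%:R / m%:R) *: (1%:M *m sigmaK sigma1 sigma2 z).
  rewrite mul1mx; apply: cV2P; rewrite !mxE /= rmorphM fmorph_div !rmorph_nat //.
split; first by rewrite divr_gt0 ?ltr0n.
  by rewrite trmx1 mulmx1.
apply/seteqP; split => w /=.
  by move=> [_ [z Iz <-] <-]; exists (sigmaK sigma1 sigma2 z); [exists z|rewrite E].
by move=> [_ [z Iz <-] <-]; exists (n%:R / m%:R * z); [exists z|rewrite E].
Qed.

Lemma finitely_many_WR_twistable :
  exists S : set (set K),
    [/\ finite_set S,
        forall J, S J -> is_nonzero_ideal J /\
          canonical_basis_WR_twistable D s sigma1 sigma2 J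
      & forall I : set K, is_nonzero_ideal I ->
          canonical_basis_WR_twistable D s sigma1 sigma2 I ->
          exists2 J, S J &
            similar_lattices (sigmaK sigma1 sigma2 @` I)
                             (sigmaK sigma1 sigma2 @` J)].
Proof.
pose good (c : nat * nat) (J : set K) := is_nonzero_ideal J /\
  exists a b g : nat, [/\ is_canonical_basis D s J a b g,
    WR_twistable sigma1 sigma2 a%:R (second_basis_elt D s b g) &
    c = ((a %/ g)%N, (b %/ g)%N)].
pose P : set (nat * nat) := [set c | exists J, good c J].
(* One twistable ideal is chosen for each attained pair (a / g, b / g). The default [set0] is never
   taken on [P], and [f] is only applied there. *)
pose f (c : nat * nat) : set K := xget set0 [set J | good c J].
have fP c : P c -> good c (f c).
  by move=> [J cJ]; apply: (@xgetPex _ set0 [set J | good c J]); exists J.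
exists (f @` P); split.
- apply/finite_image/(@sub_finite_set _ _ (`I_(2 * D) `*` `I_(2 * D))).
    move=> c [J [_ [a [b [g [[_ ba ga gb _] wr ->]]]]]] /=.
    exact: WR_twistable_small wr.
  by apply: finite_setX; apply: finite_II.
- move=> _ [c /fP[nzJ [a [b [g [cb wr _]]]]] <-]; split => //.
  by exists a, b, g.
- move=> I nzI [a [b [g [cb wr]]]].
  set c := ((a %/ g)%N, (b %/ g)%N).
  have Pc : P c by exists I; split => //; exists a, b, g.
  exists (f c); first by exists c.
  have [_ [a' [b' [g' [cb' _ [ca cb2]]]]]] := fP c Pc.
  have [_ ba ga gb _] := cb; have [_ ba' ga' gb' _] := cb'.
  have [g0 _] := canonical_lt ba ga gb; have [g'0 _] := canonical_lt ba' ga' gb'.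
  rewrite (canonical_basis_dilation g0 g'0 ga gb ga' gb' ca cb2 cb cb').
  exact: similar_dilation.
Qed.

Lemma WR_twistable_b_lt (a b g : nat) :
  (b < a)%N -> (g %| a)%N -> (g %| b)%N ->
  WR_twistable sigma1 sigma2 a%:R (second_basis_elt D s b g) ->
  b%:R < (if (D %% 4 == 1)%N then (Num.sqrt D%:R - 1) * g%:R / 2
          else g%:R * Num.sqrt D%:R) :> R.
Proof.
move=> ba ga gb /(WR_twistable_bounds ba ga gb)[+ _ _].
rewrite sigma1_beta /omega /tau; case: ifP => _ /=; lra.
Qed.

(** Writing 1 = a x + beta y and subtracting conjugates gives g [omega] y = 0, so y = 0 and a x = 1.
    This pins down the canonical basis of the ring of integers. *)
Lemma canonical_basis_one (I : set K) (a b g : nat) :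
  is_canonical_basis D s I a b g -> I 1 -> [/\ a = 1, b = 0 & g = 1]%N.
Proof.
move=> [-> ba ga gb _] [x [y xy]].
have [g0 bga] := canonical_lt ba ga gb.
have h1 := congr1 sigma1 xy; have h2 := congr1 sigma2 xy.
move: h1 h2; rewrite !rmorph1 !rmorphD !rmorphM !rmorph_nat !rmorph_int.
rewrite sigma1_beta sigma2_beta => h1 h2.
have : g%:R * omega * y%:~R = 0 :> R by lra.
move=> /eqP; rewrite !mulf_eq0 pnatr_eq0 (gtn_eqF g0) (gt_eqF omega_gt0).
rewrite intr_eq0 /= => /eqP y0.
move: h1; rewrite y0 mulr0 addr0 => /eqP.
have -> : a%:R * x%:~R = (a%:Z * x)%:~R :> R by rewrite intrM.
rewrite -[1]/(1%:~R) eqr_int => /eqP ax.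
have a1 : a = 1%N.
  apply/eqP; rewrite -dvdn1 -[a]/(`|a%:Z|%N) -[1%N]/(`|1%:Z|%N).
  by apply/dvdzP; exists x; rewrite mulrC.
by rewrite a1 in ba bga *; split => //; lia.
Qed.

Lemma ring_of_integers_WR_twistable_D5 :
  canonical_basis_WR_twistable D s sigma1 sigma2 (ring_of_integers K) -> D = 5%N.
Proof.
move=> [a [b [g [cb wr]]]].
have O1 : ring_of_integers K 1 by apply: integral1.
have [aE bE gE] := canonical_basis_one cb O1; subst a b g.
have [_ _] := WR_twistable_bounds (ltn0Sn 0) (dvdnn 1) (dvdn0 1) wr.
rewrite sigma1_beta sigma2_beta /tau /omega.
have : Num.sqrt D%:R ^+ 2 = D%:R :> R by rewrite sqr_sqrtr.
(* If D = 1 mod 4, the inequality is |5 - D| / 2 <= 1, so 3 <= D <= 7 and the congruence leaves 5.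
   Otherwise the trace is 0 and the inequality forces D = 1. *)
case: ifP => [D4|_] /= SD; rewrite ler_norml => /andP[h1 h2].
  have D7 : D%:R <= 7%:R :> R by nra.
  have D3 : 3%:R <= D%:R :> R by nra.
  by move: D7 D3; rewrite !ler_nat; lia.
by exfalso; have : 1 < D%:R :> R; [rewrite ltr1n | nra].
Qed.

End QuadraticField.

(** * Integral elements and rational coordinates *)

Lemma rat_integral_int (L : fieldType) (f : {rmorphism rat -> L}) (r : rat) :
  integralOver (intr : int -> L) (f r) -> exists n : int, r = n%:~R.
Proof.
move=> [p p_mon p_root].
have mapE (F : fieldType) (h : {rmorphism rat -> F}) :
    map_poly (intr : int -> F) p = map_poly h (map_poly (intr : int -> rat) p).
  by rewrite -map_poly_comp; apply: eq_map_poly => z /=; rewrite rmorph_int.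
have r_root : root (map_poly (intr : int -> rat) p) r.
  by move: p_root; rewrite (mapE _ f) fmorph_root.
(* The root is moved to [algC], where rational algebraic integers are known to be integers. *)
have rA : (ratr r : algC) \in Aint.
  apply: (@root_monic_Aint (map_poly (intr : int -> algC) p)).
  - by rewrite (mapE _ ratr) fmorph_root.
  - exact: monic_map.
  - by apply/polyOverP => i; rewrite coef_map /= intr_int.
have := Cint_rat_Aint (Crat_rat r) rA.
move=> /intrP[n]; rewrite -(ratr_int algC) => /fmorph_inj ->.
by exists n.
Qed.

Lemma integralOver_rmorph (L F : fieldType) (f : {rmorphism L -> F}) (x : L) :
  integralOver (intr : int -> L) x -> integralOver (intr : int -> F) (f x).
Proof.
move=> [p p_mon p_root]; exists p => //.
have -> : map_poly (intr : int -> F) p = map_poly f (map_poly (intr : int -> L) p).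
  by rewrite -map_poly_comp; apply: eq_map_poly => z /=; rewrite rmorph_int.
by rewrite fmorph_root.
Qed.

Lemma Qsqrt_decomp (K : splittingFieldType rat) (D : nat) (s x : K) :
  is_Qsqrt D s -> exists u v : rat, x = ratr u + ratr v * s.
Proof.
move=> [s2 sK].
have : x \in <<1; s>>%VS by rewrite sK memvf.
move=> /Fadjoin_polyP[_ /polyOver1P[p ->] ->].
(* Reducing modulo X^2 - D, which vanishes at [s], leaves a polynomial of degree at most 1. *)
pose q : {poly rat} := 'X^2 - D%:R%:P.
have szq : size q = 3 by rewrite size_XnsubC.
have q0 : q != 0 by rewrite -size_poly_eq0 szq.
have qs : (map_poly (in_alg K) q).[s] = 0.
  rewrite rmorphB /= map_polyXn map_polyC /= !hornerE s2.
  by rewrite scaler_nat subrr.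
have := ltn_modp p q; rewrite q0 szq => sz.
exists (p %% q)`_0, (p %% q)`_1.
rewrite {1}(divp_eq p q) rmorphD rmorphM /= hornerD hornerM qs mulr0 add0r.
rewrite (@horner_coef_wide _ 2) ?size_map_poly //.
rewrite big_ord_recl big_ord1 !coef_map /= expr0 expr1 mulr1.
by have E : GRing.in_alg K =1 ratr := fmorph_eq_rat _; rewrite -!E.
Qed.

(** The norm is a product of conjugates, each integral. It is rational because K is Galois (normal,
    of characteristic zero), hence an integer. *)
Lemma galNorm_integral_int (K : splittingFieldType rat) (x : K) :
  integralOver (intr : int -> K) x ->
  exists n : int, galNorm 1 {:K} x = n%:~R.
Proof.
move=> x_int.
have N_int : integralOver (intr : int -> K) (galNorm 1 {:K} x).
  apply: (big_ind (integralOver (intr : int -> K))).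
  - exact: integral1.
  - by move=> y z; apply: integral_mul.
  - by move=> g _; apply: integralOver_rmorph.
have galK : galois 1 {:K}.
  rewrite /galois sub1v normalFieldf andbT /=; apply/separableP => y _.
  apply: pcharf0_separable => p.
  by rewrite (fmorph_pchar (GRing.in_alg K)) pchar_num.
have /vlineP[r rE] := mem_galNorm galK (memvf x).
rewrite rE in N_int *.
have [n ->] := rat_integral_int (f := GRing.in_alg K) N_int.
by exists n; exact: (rmorph_int (GRing.in_alg K)).
Qed.

(** * Elementary arithmetic of squares *)

Lemma rat_sqr_num_den (r : rat) (a b : nat) :
  r ^+ 2 * a%:R = b%:R -> (`|numq r| ^ 2 * a = b * `|denq r| ^ 2)%N.
Proof.
rewrite -{1}(divq_num_den r) expr_div_n => h.
have d0 : (denq r)%:~R ^+ 2 != 0 :> rat by rewrite expf_neq0 // intr_eq0 denq_neq0.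
have : (numq r ^+ 2 * a%:Z)%:~R = (b%:Z * denq r ^+ 2)%:~R :> rat.
  rewrite !intrM -[b%:~R]/(b%:R) -h; field; rewrite intr_eq0 denq_neq0 //.
move=> /intr_inj /(congr1 absz).
by rewrite -!mulnn !abszM.
Qed.

Lemma squarefree5 : squarefree 5.
Proof. by case=> [|[|[|d]]] // /dvdn_leq; rewrite !expnS; lia. Qed.

(** With r = n / d in lowest terms, n^2 D = 5 d^2 gives n^2 | 5 and d^2 | D, so squarefreeness makes
    n and d units. *)
Lemma rat_sqrt_quotient (r : rat) (D : nat) : squarefree D ->
  r ^+ 2 * D%:R = 5 -> D = 5%N.
Proof.
move=> Dsf /rat_sqr_num_den h.
have cop : coprime `|numq r| `|denq r| by exact: coprime_num_den.
have n1 : `|numq r|%N = 1%N.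
  apply: squarefree5; rewrite -(@Gauss_dvdl _ _ (`|denq r| ^ 2)) ?coprimeXl ?coprimeXr //.
  by rewrite -h dvdn_mulr.
have d1 : `|denq r|%N = 1%N.
  have cop2 : coprime (`|denq r| ^ 2) (`|numq r| ^ 2).
    by rewrite coprime_sym coprimeXl ?coprimeXr.
  by apply: Dsf; rewrite -(Gauss_dvdr _ cop2) h dvdn_mull.
by move: h; rewrite n1 d1 !mul1n.
Qed.

Lemma sqr_eq5_mul (w t : int) : w * w = 5 * t -> exists n, w = 5 * n.
Proof.
move=> h; exists (w %/ 5)%Z.
have := divz_eq w 5; have := modz_ge0 w (isT : 5 != 0 :> int).
have := @ltz_pmod w 5 isT.
set q := (w %/ 5)%Z; set r := (w %% 5)%Z => r5 r0 wE.
have : r * r = 5 * (t - 5 * q * q - 2 * q * r) by rewrite wE in h; lia.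
set t' := t - _ - _ => rr.
have : r = 0 \/ r = 1 \/ r = 2 \/ r = 3 \/ r = 4 by lia.
by move=> [|[|[|[|]]]] rE; rewrite rE in rr wE; lia.
Qed.

(** Modulo 2, m^2 - 5 n^2 is (m + n)^2. *)
Lemma parity_of_form (m n k : int) : m * m - 5 * (n * n) = 4 * k ->
  exists l, m + n = 2 * l.
Proof.
move=> h; exists ((m + n) %/ 2)%Z.
have := divz_eq (m + n) 2; have := modz_ge0 (m + n) (isT : 2 != 0 :> int).
have := @ltz_pmod (m + n) 2 isT.
set q := ((m + n) %/ 2)%Z; set r := ((m + n) %% 2)%Z => r5 r0 wE.
have mE : m = 2 * q + r - n by lia.
have : r * r = 2 * (2 * k + 2 * (n * n) - 2 * q * q - 2 * q * r + 2 * q * n + r * n).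
  by rewrite mE in h; lia.
set t' := _ + r * n => rr.
have : r = 0 \/ r = 1 by lia.
by move=> [] rE; rewrite rE in rr wE; lia.
Qed.

(** * The field generated by sqrt 5 *)

Section Field5.
Context (R : realType) (K : splittingFieldType rat) (s : K) (hK : is_Qsqrt 5 s).
Context (sigma1 sigma2 : {rmorphism K -> R}).
Context (hsigma1 : sigma1 s = Num.sqrt 5%:R).
Context (hsigma2 : sigma2 s = - Num.sqrt 5%:R).

Lemma delta5E : delta 5 s = (1 - s) / 2.
Proof. by []. Qed.

Lemma delta5_integral : integralOver (intr : int -> K) (delta 5 s).
Proof.
(* The conjugates of delta have sum 1 and product -1. *)
exists ('X^2 - ('X + 1%:P)).
  by rewrite monicE lead_coefDl ?lead_coefXn // size_polyXn size_polyN size_XaddC.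
apply/rootP; rewrite rmorphB rmorphD /= map_polyXn map_polyX map_polyC /=.
rewrite !hornerE delta5E expr_div_n sqrrB expr1n mul1r hK.1.
by field; rewrite !splitting_rat_natr_eq0.
Qed.

(** For integral x = u + v sqrt 5, the trace 2u, the norm u^2 - 5 v^2 and sqrt 5 times the
    difference of conjugates, 10 v, are rational and integral, hence integers m, k, w. Divisibility
    of w by 5 and the parity of m + 2v then give integer coordinates. *)
Lemma ring_of_integers5 :
  ring_of_integers K =
  [set z | exists x y : int, z = 1%:R * x%:~R + second_basis_elt 5 s 0 1 * y%:~R].
Proof.
rewrite /second_basis_elt add0r !mul1r; apply/seteqP; split => x /=; last first.
  move=> [m [n ->]]; rewrite mul1r.
  apply: integral_add; first exact: integral_id.
  by apply: integral_mul; [exact: delta5_integral | exact: integral_id].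
move=> x_int.
have x1_int := integralOver_rmorph sigma1 x_int.
have x2_int := integralOver_rmorph sigma2 x_int.
have [u [v xE]] := Qsqrt_decomp x hK.
have S5 : Num.sqrt 5%:R ^+ 2 = 5%:R :> R by rewrite sqr_sqrtr.
have x1E : sigma1 x = ratr u + ratr v * Num.sqrt 5%:R.
  by rewrite xE rmorphD [sigma1 (_ * s)]rmorphM !fmorph_rat hsigma1.
have x2E : sigma2 x = ratr u - ratr v * Num.sqrt 5%:R.
  by rewrite xE rmorphD [sigma2 (_ * s)]rmorphM !fmorph_rat hsigma2 mulrN.
have s_int : integralOver (intr : int -> R) (Num.sqrt 5%:R).
  exists ('X^2 - 5%:P).
    by rewrite monicE lead_coefDl ?lead_coefXn // size_polyXn size_polyN size_polyC.
  by apply/rootP; rewrite rmorphB /= map_polyXn map_polyC /= !hornerE S5 subrr.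
have [m mE] : exists m : int, 2 * u = m%:~R.
  apply: (@rat_integral_int R ratr) => /=.
  have -> : ratr (2 * u) = sigma1 x + sigma2 x.
    by rewrite rmorphM /= rmorph_nat x1E x2E; ring.
  exact: integral_add.
have [k kE] : exists k : int, u * u - 5 * (v * v) = k%:~R.
  apply: (@rat_integral_int R ratr) => /=.
  have -> : ratr (u * u - 5 * (v * v)) = sigma1 x * sigma2 x.
    rewrite rmorphB !rmorphM /= rmorph_nat x1E x2E.
    by move: S5; move: (Num.sqrt 5%:R) => r <-; ring.
  exact: integral_mul.
have [w wE] : exists w : int, 10 * v = w%:~R.
  apply: (@rat_integral_int R ratr) => /=.
  have -> : ratr (10 * v) = Num.sqrt 5%:R * (sigma1 x - sigma2 x).
    rewrite rmorphM /= rmorph_nat x1E x2E.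
    have -> : 10%:R = 2 * 5%:R :> R by rewrite -natrM.
    by move: S5; move: (Num.sqrt 5%:R) => r <-; ring.
  by apply: integral_mul => //; apply: integral_sub.
(* Here w^2 = 100 v^2 and m^2 - 4k = 20 v^2. *)
have [n nE] : exists n, w = 5 * n.
  apply: (@sqr_eq5_mul w (m * m - 4 * k)); apply: (@intr_inj rat).
  by rewrite !intrM intrB !intrM -mE -kE -wE; ring.
have vE : 2 * v = n%:~R.
  by move: wE; rewrite nE intrM => h; lra.
have [l lE] : exists l, m + n = 2 * l.
  apply: (@parity_of_form m n k); apply: (@intr_inj rat).
  by rewrite intrB !intrM -mE -kE -vE; ring.
(* From u = l - v and n = 2v one gets x = l - n delta. *)
exists l, (- n); rewrite mul1r delta5E.
have uE : u = l%:~R - v.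
  have : (m + n)%:~R = (2 * l)%:~R :> rat by rewrite lE.
  by rewrite intrD intrM -mE -vE => h; lra.
have E : GRing.in_alg K =1 ratr := fmorph_eq_rat _.
have nK : n%:~R = 2 * GRing.in_alg K v.
  by rewrite -(rmorph_int (GRing.in_alg K)) -vE rmorphM rmorph_nat.
have lK : ratr u = l%:~R - GRing.in_alg K v.
  by rewrite -E uE rmorphB rmorph_int.
rewrite xE lK -E rmorphN /= nK /=.
by move: (GRing.in_alg K v) => V; field; rewrite !splitting_rat_natr_eq0.
Qed.

Lemma ring_of_integers5_WR_twistable :
  canonical_basis_WR_twistable 5 s sigma1 sigma2 (ring_of_integers K).
Proof.
exists 1%N, 0%N, 1%N; split.
  split => //; first exact: ring_of_integers5.
  have [n nE] := galNorm_integral_int delta5_integral.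
  by exists n; [rewrite /second_basis_elt add0r mul1r | rewrite dvd1z].
have S5 : Num.sqrt 5%:R ^+ 2 = 5%:R :> R by rewrite sqr_sqrtr.
have S0 : 0 < Num.sqrt 5%:R :> R by rewrite sqrtr_gt0.
(* With r = sqrt 5, equal lengths require p / q = (r + 1) / (r - 1) = (5 + r) / (5 - r), and these
   last two terms are positive conjugates up to the factor 2. *)
apply/WR_twistableP; exists ((5 + s) / 2) => /=.
rewrite (sigma1_beta hsigma1) (sigma2_beta hsigma2) /tau /omega /=.
rewrite !fmorph_div [sigma1 (_ + s)]rmorphD [sigma2 (_ + s)]rmorphD.
rewrite hsigma1 hsigma2 !rmorph_nat.
move: S5 S0; move: (Num.sqrt 5%:R) => r r2 r0.
have r5 : r < 5 by nra.
split; [lra | lra | by apply/eqP; lra | | ].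
  apply/eqP; rewrite -subr_eq0; apply/eqP.
  transitivity (3 / 4 * (r ^+ 2 - 5)); first by field.
  by rewrite r2 subrr mulr0.
(* The twisted basis vectors are orthogonal, so the lattice is square. *)
rewrite (_ : 2 * _ = 5 - r ^+ 2); last by field.
by rewrite r2 subrr normr0; lra.
Qed.

End Field5.

(** Write t = u + v sqrt D. Both embeddings of t square to 5, so u v = 0. If u = 0 then v^2 D = 5
    and D = 5; if v = 0 then 5 would be a rational square. *)
Lemma Qsqrt5_unique (R : realType) (D : nat) (K : splittingFieldType rat) (s t : K)
    (sigma1 sigma2 : {rmorphism K -> R}) :
  (1 < D)%N -> squarefree D -> is_Qsqrt D s ->
  sigma1 s = Num.sqrt D%:R -> sigma2 s = - Num.sqrt D%:R ->
  is_Qsqrt 5 t -> D = 5%N.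
Proof.
move=> D1 Dsf hK h1 h2 [t2 _].
have [u [v tE]] := Qsqrt_decomp t hK.
have SD : Num.sqrt D%:R ^+ 2 = D%:R :> R by rewrite sqr_sqrtr.
have S0 : Num.sqrt D%:R != 0 :> R by rewrite sqrtr_eq0 -ltNge ltr0n; lia.
have e1 : (ratr u + ratr v * Num.sqrt D%:R) ^+ 2 = 5 :> R.
  by rewrite -h1 -!(fmorph_rat sigma1) -rmorphM -rmorphD -tE -rmorphXn /= t2 rmorph_nat.
have e2 : (ratr u - ratr v * Num.sqrt D%:R) ^+ 2 = 5 :> R.
  rewrite -mulrN -h2 -!(fmorph_rat sigma2) -rmorphM -rmorphD -tE.
  by rewrite -rmorphXn /= t2 rmorph_nat.
have : ratr u * ratr v * Num.sqrt D%:R = 0 :> R by lra.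
move/eqP; rewrite mulf_eq0 (negPf S0) orbF mulf_eq0 !fmorph_eq0 => /orP[] /eqP uv0.
  apply: (@rat_sqrt_quotient v) => //; apply: (fmorph_inj (ratr : rat -> R)).
  by rewrite rmorphM rmorphXn /= !rmorph_nat -SD -exprMn -e1 uv0 rmorph0 add0r.
have : u ^+ 2 * 1%:R = 5%:R.
  rewrite mulr1; apply: (fmorph_inj (ratr : rat -> R)).
  by rewrite rmorphXn /= rmorph_nat -e1 uv0 rmorph0 mul0r addr0.
move=> /rat_sqr_num_den; rewrite muln1 mulnC => h.
have n0 : (0 < `|numq u|)%N.
  rewrite lt0n; apply/eqP => n0; move: h => /eqP.
  by rewrite n0 eq_sym muln_eq0 expn_eq0 absz_eq0 denq_eq0.
by have := squarefree_sqr_neq `|denq u| (isT : (1 < 5)%N) squarefree5 n0; rewrite h eqxx.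
Qed.

Theorem theorem1p5 (R : realType) (D : nat) (hD1 : (1 < D)%N)
    (hDsf : squarefree D)
    (K : splittingFieldType rat) (s : K) (hK : is_Qsqrt D s)
    (sigma1 sigma2 : {rmorphism K -> R})
    (hsigma1 : sigma1 s = Num.sqrt D%:R)
    (hsigma2 : sigma2 s = - Num.sqrt D%:R) :
  [/\ exists S : set (set K),
        [/\ finite_set S,
            forall J, S J -> is_nonzero_ideal J /\
              canonical_basis_WR_twistable D s sigma1 sigma2 J
          & forall I : set K, is_nonzero_ideal I ->
              canonical_basis_WR_twistable D s sigma1 sigma2 I ->
              exists2 J, S J &
                similar_lattices (sigmaK sigma1 sigma2 @` I)
                                 (sigmaK sigma1 sigma2 @` J)],
      forall (I : set K) (a b g : nat), is_nonzero_ideal I ->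
        is_canonical_basis D s I a b g ->
        WR_twistable sigma1 sigma2 a%:R (second_basis_elt D s b g) ->
        b%:R < (if (D %% 4 == 1)%N then (Num.sqrt D%:R - 1) * g%:R / 2
                else g%:R * Num.sqrt D%:R) :> R
    & canonical_basis_WR_twistable D s sigma1 sigma2 (ring_of_integers K)
        <-> exists t : K, is_Qsqrt 5 t].
Proof.
split.
- exact: finitely_many_WR_twistable.
- by move=> I a b g _ [_ ba ga gb _]; apply: WR_twistable_b_lt.
- split=> [wr | [t ht]].
    have D5 : D = 5%N := ring_of_integers_WR_twistable_D5 hD1 hDsf hsigma1 hsigma2 wr.
    by exists s; rewrite -D5.
  have D5 := Qsqrt5_unique hD1 hDsf hK hsigma1 hsigma2 ht; subst D.
  exact: ring_of_integers5_WR_twistable.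
Qed.
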